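(* Let $I\subseteq(0,\infty)$ be an interval, $M\ge 0$, let $f:I\to\mathbb{R}$ be an $M$-Lipschitzian function on $I$, let $a,b\in I$ with $a<b$, $\lambda\in[0,1]$, $\alpha>0$, $C=a^{1-\lambda}b^{\lambda}$, and let $x,y\in[a,b]$ with $x\le y$. Then $$|S_f(x,y,\lambda,\alpha,a,b)|\le\frac{\alpha M\,C_{\alpha,\lambda}(x,y)}{\left(\ln\frac{b}{a}\right)^{\alpha}}.$$
   Context: A function $f:I\to\mathbb{R}$ is $M$-Lipschitzian on $I$ ($M\ge0$) if $|f(u)-f(v)|\le M|u-v|$ for all $u,v\in I$. For $\alpha>0$ and $c\in[a,b]$ the Hadamard fractional integrals used are $$J_{c-}^{\alpha}f(a)=\frac{1}{\Gamma(\alpha)}\int_a^c\Big(\ln\frac{t}{a}\Big)^{\alpha-1}f(t)\frac{dt}{t},\qquad J_{c+}^{\alpha}f(b)=\frac{1}{\Gamma(\alpha)}\int_c^b\Big(\ln\frac{b}{t}\Big)^{\alpha-1}f(t)\frac{dt}{t},$$ (equal to $0$ when the interval of integration is a point), where $\Gamma$ is the Euler Gamma function; $0^\alpha=0$. Define $$S_f(x,y,\lambda,\alpha,a,b)=\lambda^{\alpha}f(x)+(1-\lambda)^{\alpha}f(y)-\frac{\Gamma(\alpha+1)}{\left(\ln\frac{b}{a}\right)^{\alpha}}\big[J_{C-}^{\alpha}f(a)+J_{C+}^{\alpha}f(b)\big].$$ The quantity $C_{\alpha,\lambda}(x,y)$ is defined by cases: (1) If $a\le C\le x\le y\le b$,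 then $$C_{\alpha,\lambda}(x,y)=\frac{x}{\alpha}\lambda^{\alpha}\Big(\ln\frac{b}{a}\Big)^{\alpha}+\frac{y}{\alpha}\Big\{(1-\lambda)^{\alpha}\Big(\ln\frac{b}{a}\Big)^{\alpha}-2\Big(\ln\frac{b}{y}\Big)^{\alpha}\Big\}+\int_y^b\Big(\ln\frac{b}{t}\Big)^{\alpha-1}dt-\int_C^y\Big(\ln\frac{b}{t}\Big)^{\alpha-1}dt-\int_a^C\Big(\ln\frac{t}{a}\Big)^{\alpha-1}dt.$$ (2) If $a\le x\le C\le y\le b$, then $$C_{\alpha,\lambda}(x,y)=\frac{x}{\alpha}\Big\{2\Big(\ln\frac{x}{a}\Big)^{\alpha}-\lambda^{\alpha}\Big(\ln\frac{b}{a}\Big)^{\alpha}\Big\}+\frac{y}{\alpha}\Big\{(1-\lambda)^{\alpha}\Big(\ln\frac{b}{a}\Big)^{\alpha}-2\Big(\ln\frac{b}{y}\Big)^{\alpha}\Big\}+\int_x^C\Big(\ln\frac{t}{a}\Big)^{\alpha-1}dt-\int_a^x\Big(\ln\frac{t}{a}\Big)^{\alpha-1}dt+\int_y^b\Big(\ln\frac{b}{t}\Big)^{\alpha-1}dt-\int_C^y\Big(\ln\frac{b}{t}\Big)^{\alpha-1}dt.$$ (3) If $a\le x\le y\le C\le b$, then $$C_{\alpha,\lambda}(x,y)=\frac{x}{\alpha}\Big\{2\Big(\ln\frac{x}{a}\Big)^{\alpha}-\lambda^{\alpha}\Big(\ln\frac{b}{a}\Big)^{\alpha}\Big\}-\frac{y}{\alpha}(1-\lambda)^{\alpha}\Big(\ln\frac{b}{a}\Big)^{\alpha}+\int_C^b\Big(\ln\frac{b}{t}\Big)^{\alpha-1}dt+\int_x^C\Big(\ln\frac{t}{a}\Big)^{\alpha-1}dt-\int_a^x\Big(\ln\frac{t}{a}\Big)^{\alpha-1}dt.$$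 *)

(* Defs.v *)
From mathcomp Require Import all_boot all_order all_algebra.
From mathcomp Require Import all_classical all_reals all_analysis.
From mathcomp Require Import ring.
Set Implicit Arguments.
Unset Strict Implicit.
Unset Printing Implicit Defensive.
Import Order.TTheory GRing.Theory Num.Theory.
Import numFieldNormedType.Exports.
Local Open Scope classical_set_scope.
Local Open Scope ring_scope.

Section HadamardLipschitz.
Variable R : realType.
Implicit Types (f : R -> R) (a b c x y s alpha lambda : R).

Local Notation mu := (@lebesgue_measure R).

(* Only used for s > 0, where the integral is finite. *)
Definition Gamma s : R :=
  \int[mu]_(t in `]0, +oo[) (t `^ (s - 1) * expR (- t)).

(* All integrals are Lebesgue integrals: for 0 < alpha < 1 the kernels are
   unbounded near one endpoint, and an integral over a one-point interval is
   0. As 0 `^ s = 0 for s != 0, the boundary terms satisfy 0^alpha = 0. *)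

(* J_{c-}^alpha f(a) *)
Definition hadamard_minus alpha c f a : R :=
  (Gamma alpha)^-1 *
    \int[mu]_(t in `[a, c]) (ln (t / a) `^ (alpha - 1) * f t / t).

(* J_{c+}^alpha f(b) *)
Definition hadamard_plus alpha c f b : R :=
  (Gamma alpha)^-1 *
    \int[mu]_(t in `[c, b]) (ln (b / t) `^ (alpha - 1) * f t / t).

Definition geo_mean a b lambda : R := a `^ (1 - lambda) * b `^ lambda.

Definition S_ f x y lambda alpha a b : R :=
  let C := geo_mean a b lambda in
  lambda `^ alpha * f x + (1 - lambda) `^ alpha * f y
  - Gamma (alpha + 1) / ln (b / a) `^ alpha
    * (hadamard_minus alpha C f a + hadamard_plus alpha C f b).

(* a <= C <= x <= y <= b *)
Definition C_case1 a b alpha lambda x y : R :=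
  let C := geo_mean a b lambda in
  x / alpha * (lambda `^ alpha * ln (b / a) `^ alpha)
  + y / alpha * ((1 - lambda) `^ alpha * ln (b / a) `^ alpha
                 - 2 * ln (b / y) `^ alpha)
  + \int[mu]_(t in `[y, b]) (ln (b / t) `^ (alpha - 1))
  - \int[mu]_(t in `[C, y]) (ln (b / t) `^ (alpha - 1))
  - \int[mu]_(t in `[a, C]) (ln (t / a) `^ (alpha - 1)).

(* a <= x <= C <= y <= b *)
Definition C_case2 a b alpha lambda x y : R :=
  let C := geo_mean a b lambda in
  x / alpha * (2 * ln (x / a) `^ alpha
               - lambda `^ alpha * ln (b / a) `^ alpha)
  + y / alpha * ((1 - lambda) `^ alpha * ln (b / a) `^ alpha
                 - 2 * ln (b / y) `^ alpha)
  + \int[mu]_(t in `[x, C]) (ln (t / a) `^ (alpha - 1))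
  - \int[mu]_(t in `[a, x]) (ln (t / a) `^ (alpha - 1))
  + \int[mu]_(t in `[y, b]) (ln (b / t) `^ (alpha - 1))
  - \int[mu]_(t in `[C, y]) (ln (b / t) `^ (alpha - 1)).

(* a <= x <= y <= C <= b *)
Definition C_case3 a b alpha lambda x y : R :=
  let C := geo_mean a b lambda in
  x / alpha * (2 * ln (x / a) `^ alpha
               - lambda `^ alpha * ln (b / a) `^ alpha)
  - y / alpha * ((1 - lambda) `^ alpha * ln (b / a) `^ alpha)
  + \int[mu]_(t in `[C, b]) (ln (b / t) `^ (alpha - 1))
  + \int[mu]_(t in `[x, C]) (ln (t / a) `^ (alpha - 1))
  - \int[mu]_(t in `[a, x]) (ln (t / a) `^ (alpha - 1)).

(* C_{alpha,lambda}(x,y), for a <= x <= y <= b. The three cases overlap when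
   C = x or C = y; C_coeffE2 and C_coeffE3 show that the formulas then agree. *)
Definition C_coeff a b alpha lambda x y : R :=
  let C := geo_mean a b lambda in
  if C <= x then C_case1 a b alpha lambda x y
  else if C <= y then C_case2 a b alpha lambda x y
  else C_case3 a b alpha lambda x y.

Lemma ln_geo_mean_minus a b lambda : 0 < a -> a < b ->
  ln (geo_mean a b lambda / a) = lambda * ln (b / a).
Proof.
move=> a0 ab; have b0 := lt_trans a0 ab.
rewrite !ln_div ?posrE ?mulr_gt0 ?powR_gt0// /geo_mean lnM ?posrE ?powR_gt0//.
by rewrite !ln_powR; ring.
Qed.

Lemma ln_geo_mean_plus a b lambda : 0 < a -> a < b ->
  ln (b / geo_mean a b lambda) = (1 - lambda) * ln (b / a).
Proof.
move=> a0 ab; have b0 := lt_trans a0 ab.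
rewrite !ln_div ?posrE ?mulr_gt0 ?powR_gt0// /geo_mean lnM ?posrE ?powR_gt0//.
by rewrite !ln_powR; ring.
Qed.

Lemma C_coeffE1 a b alpha lambda x y : geo_mean a b lambda <= x ->
  C_coeff a b alpha lambda x y = C_case1 a b alpha lambda x y.
Proof. by rewrite /C_coeff => ->. Qed.

Lemma C_coeffE2 a b alpha lambda x y : 0 < a -> a < b -> 0 <= lambda <= 1 ->
  x <= geo_mean a b lambda <= y ->
  C_coeff a b alpha lambda x y = C_case2 a b alpha lambda x y.
Proof.
move=> a0 ab /andP[l0 l1] /andP[xC Cy].
have L0 : 0 <= ln (b / a) by rewrite ln_ge0// ler_pdivlMr// mul1r ltW.
rewrite /C_coeff; case: ifPn => [Cx|_]; last by rewrite Cy.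
have xE : x = geo_mean a b lambda by apply/eqP; rewrite eq_le xC Cx.
subst x; rewrite /C_case1 /C_case2 (ln_geo_mean_minus _ a0 ab) (powRM alpha l0 L0).
rewrite (set_itv1 (geo_mean a b lambda)) Rintegral_set1.
by do 3![move: (Rintegral _ _ _) => ?]; ring.
Qed.

Lemma C_coeffE3 a b alpha lambda x y : 0 < a -> a < b -> 0 <= lambda <= 1 ->
  x <= y -> y <= geo_mean a b lambda ->
  C_coeff a b alpha lambda x y = C_case3 a b alpha lambda x y.
Proof.
move=> a0 ab l01 xy yC.
have /andP[l0 l1] := l01.
have L0 : 0 <= ln (b / a) by rewrite ln_ge0// ler_pdivlMr// mul1r ltW.
have [Cy|yltC] := leP (geo_mean a b lambda) y; last first.
  by rewrite /C_coeff !leNgt yltC (le_lt_trans xy yltC).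
have yE : y = geo_mean a b lambda by apply/eqP; rewrite eq_le yC Cy.
rewrite (C_coeffE2 alpha a0 ab l01); last by rewrite Cy (le_trans xy yC).
have l1' : 0 <= 1 - lambda by rewrite subr_ge0.
subst y; rewrite /C_case2 /C_case3 (ln_geo_mean_plus _ a0 ab) (powRM alpha l1' L0).
rewrite (set_itv1 (geo_mean a b lambda)) Rintegral_set1.
by do 3![move: (Rintegral _ _ _) => ?]; ring.
Qed.

End HadamardLipschitz.

(* Main.v *)
Require Import Defs.
From mathcomp Require Import all_boot all_order all_algebra.
From mathcomp Require Import all_classical all_reals all_analysis.
From mathcomp Require Import measurable_realfun ring lra.
Import Order.TTheory GRing.Theory Num.Theory.
Import numFieldNormedType.Exports.
Local Open Scope classical_set_scope.
Local Open Scope ring_scope.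

(** The kernels [ln (t / a) `^ (alpha - 1) / t] on [[a, C]] and
    [ln (b / t) `^ (alpha - 1) / t] on [[C, b]] have total masses
    [lambda `^ alpha * ln (b / a) `^ alpha / alpha] and
    [(1 - lambda) `^ alpha * ln (b / a) `^ alpha / alpha], because
    [ln (t / a) `^ alpha / alpha] and [- ln (b / t) `^ alpha / alpha] are
    antiderivatives and [C] is the weighted geometric mean. Since
    [Gamma (alpha + 1) = alpha * Gamma alpha], the quantity [S_] is therefore
    [alpha / ln (b / a) `^ alpha] times the sum of the integrals of [f x - f t]
    against the first kernel and of [f y - f t] against the second. The
    Lipschitz condition bounds this by [M] times the integrals of [`|x - t|] and
    [`|y - t|] against the kernels ([lipschitz_log_kernel]). Splitting these at
    [x] and [y] and integrating explicitly ([deviation_le], [deviation_ge],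
    [deviation_mid]) yields exactly [C_coeff], whose three cases are the three
    positions of [C] with respect to [x] and [y].

    Two analytic points need care. For [alpha < 1] the kernels are unbounded at
    an endpoint, so a fundamental theorem of calculus on the open interval is
    needed ([ge0_continuous_FTC2oo]). And the functional equation of the Gamma
    function has to be established together with [0 < Gamma alpha]
    ([GammaD1], [Gamma_gt0]), as the quotient of two Gamma values occurs in [S_]
    and a divergent integral would make both of them 0. *)

(** * Improper integrals of nonnegative functions *)

(** Exhausting a set by an increasing sequence of segments is how both kinds of
    improper integrals below (singular endpoint, unbounded domain) are reduced
    to integrals of continuous functions over segments. *)
Lemma ge0_cvg_integral_itvcc {R : realType} (u v : nat -> R) (D : set R)
    (f : R -> R) :
  measurable_fun D f -> (forall x, D x -> 0 <= f x) ->
  {homo u : m n / (m <= n)%N >-> n <= m} -> {homo v : m n / (m <= n)%N >-> m <= n} ->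
  \bigcup_n `[u n, v n]%classic = D ->
  (\int[lebesgue_measure]_(x in `[u n, v n]) (f x)%:E)%E @[n --> \oo] -->
  (\int[lebesgue_measure]_(x in D) (f x)%:E)%E.
Proof.
move=> mf f0 du iv DE.
have sD n : (`[u n, v n]%classic : set R) `<=` D by rewrite -DE => x xn; exists n.
rewrite -DE; apply: ge0_nondecreasing_set_cvg_integral => //.
- move=> m n mn; rewrite subsetEset => x /=; rewrite !in_itv/= => /andP[ux xv].
  by rewrite (le_trans (du _ _ mn) ux) (le_trans xv (iv _ _ mn)).
- by move=> n; apply/measurable_EFinP; apply: measurable_funS mf => //;
    rewrite -DE; exact: bigcupT_measurable.
- by move=> n x unx; rewrite lee_fin f0//; exact: (sD n).
Qed.

(** The second fundamental theorem of calculus for a nonnegative integrand that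
    is continuous only on the open interval, hence possibly unbounded at both
    endpoints: only the antiderivative has to extend continuously. The values
    of [f] at [a] and [b] are irrelevant. *)
Lemma ge0_continuous_FTC2oo {R : realType} (f F : R -> R) (a b : R) :
  a < b -> {in `]a, b[, forall x, 0 <= f x} -> {in `]a, b[, continuous f} ->
  {in `]a, b[, forall x : R, is_derive x 1 F (f x)} ->
  F x @[x --> a^'+] --> F a -> F x @[x --> b^'-] --> F b ->
  (\int[lebesgue_measure]_(x in `[a, b]) (f x)%:E = (F b)%:E - (F a)%:E)%E.
Proof.
move=> ab f0 cf dF Fa Fb.
have mf : measurable_fun `]a, b[ f.
  by apply: open_continuous_measurable_fun => // x; rewrite inE/=; exact: cf.
rewrite integral_itv_bndoo; last exact/measurable_EFinP.
have d0 : 0 < b - a by rewrite subr_gt0.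
(* n.+3 makes the margin at most a third of the length, so that u n < v n. *)
pose e n : R := (b - a) / n.+3%:R.
have e0 n : 0 < e n by rewrite divr_gt0.
have e3 n : e n <= (b - a) / 3%:R.
  by rewrite ler_wpM2l ?(ltW d0)// lef_pV2 ?posrE// ler_nat.
have ie : {homo e : m n / (m <= n)%N >-> n <= m}.
  by move=> m n mn; rewrite ler_wpM2l ?(ltW d0)// lef_pV2 ?posrE// ler_nat.
have ce : e n @[n --> \oo] --> 0.
  rewrite -(mulr0 (b - a)); apply: cvgMr.
  have := @cvg_harmonic R; rewrite -cvg_shiftS -cvg_shiftS; exact.
pose u n := a + e n; pose v n := b - e n.
have uv n : u n < v n by rewrite /u /v; have := e3 n; have := d0; lra.
have au n : a < u n by rewrite ltrDl.
have vb n : v n < b by rewrite ltrBlDr ltrDl.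
have cu : u n @[n --> \oo] --> a.
  by rewrite -[X in _ --> X]addr0; apply: cvgD => //; exact: cvg_cst.
have cv : v n @[n --> \oo] --> b.
  by rewrite -[X in _ --> X]subr0; apply: cvgB => //; exact: cvg_cst.
have uvab n x : x \in `[u n, v n] -> x \in `]a, b[.
  by rewrite !in_itv/= => /andP[ux xv]; rewrite (lt_le_trans (au n))// (le_lt_trans xv).
have cI : (\int[lebesgue_measure]_(x in `[u n, v n]) (f x)%:E)%E @[n --> \oo] -->
          (\int[lebesgue_measure]_(x in `]a, b[) (f x)%:E)%E.
  apply: ge0_cvg_integral_itvcc => //.
  - by move=> m n mn; rewrite lerD2l ie.
  - by move=> m n mn; rewrite lerD2l lerN2 ie.
  - apply/seteqP; split => [x [n _ /= /uvab//]|x /=].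
    rewrite in_itv/= => /andP[ax xb].
    have : \forall n \near \oo, u n <= x /\ x <= v n.
      near=> n; split; near: n; first exact: (cvgr_le a cu).
      exact: (cvgr_ge b cv).
    by move=> [N _ /(_ N (leqnn _))[]] uN vN; exists N; rewrite //= in_itv/= uN vN.
have cFu : F (u n) @[n --> \oo] --> F a.
  by move/cvg_at_rightP : Fa; apply; split.
have cFv : F (v n) @[n --> \oo] --> F b.
  by move/cvg_at_leftP : Fb; apply; split.
have cE : (F (v n) - F (u n))%:E @[n --> \oo] --> (F b - F a)%:E.
  by apply: cvg_EFin; [exact: nearW|exact: cvgB].
apply: (cvg_unique _ cI) => //; move: cE; apply: cvg_trans.
apply: near_eq_cvg; apply: nearW => n /=.
rewrite EFinB; apply/esym; apply: continuous_FTC2 => //.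
- by apply: continuous_in_subspaceT => x; rewrite inE/= => /uvab/cf.
- have : {within `[u n, v n], continuous F}.
    by apply: derivable_within_continuous => x /uvab/dF[].
  move=> /(continuous_within_itvP _ (uv n))[_ ? ?]; split => // x xuv.
  by have /uvab/dF[] : x \in `[u n, v n] by exact: subset_itv_oo_cc.
- move=> x xuv; have /uvab/dF : x \in `[u n, v n] by exact: subset_itv_oo_cc.
  by move=> ?; rewrite derive1E derive_val.
Unshelve. all: by end_near. Qed.

(** * The Gamma function *)

(** The integrand of the Gamma function. *)
Definition gamma_density {R : realType} (s t : R) : R := t `^ (s - 1) * expR (- t).

(** The Gamma integral as an extended real: the functional equation is proved
    here, where no integrability is needed, and finiteness is deduced from it
    afterwards. *)
Definition egamma {R : realType} (s : R) : \bar R :=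
  (\int[lebesgue_measure]_(t in `]0%R, +oo[) (gamma_density s t)%:E)%E.

Lemma GammaE {R : realType} (s : R) : Gamma s = fine (egamma s).
Proof. by []. Qed.

Lemma gamma_density_ge0 {R : realType} (s t : R) : 0 <= gamma_density s t.
Proof. by rewrite mulr_ge0 ?powR_ge0 ?expR_ge0. Qed.

Lemma continuous_gamma_density {R : realType} (s : R) :
  {in `]0, +oo[, continuous (gamma_density s)}.
Proof.
move=> t; rewrite in_itv/= andbT => t0.
apply/differentiable_continuous/derivable1_diffP.
by apply: derivableM => //; apply: derivable_powR; rewrite in_itv/= t0.
Qed.

Lemma measurable_gamma_density {R : realType} (s : R) D :
  measurable_fun D (gamma_density s).
Proof.
apply: measurable_funTS; apply: measurable_funM => //.
by apply: measurableT_comp => //; exact: measurableT_comp.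
Qed.

Lemma is_derive_powRM_expRN {R : realType} (s t : R) : 0 < t ->
  is_derive t 1 (fun t => - (t `^ s * expR (- t)))
    (gamma_density (s + 1) t - s * gamma_density s t).
Proof.
move=> t0; have dp := is_derive1_powR s t0.
apply: is_derive_eq.
rewrite /gamma_density addrK /GRing.scale/=; ring.
Qed.

Lemma cvg_exprn_expRN {R : realType} (N : nat) :
  n.+2%:R ^+ N * expR (- n.+2%:R) @[n --> \oo] --> (0 : R).
Proof.
apply: (@squeeze_cvgr _ _ _ _ (fun=> 0) (fun n => N.+1`!%:R * n.+2%:R^-1)).
- near=> n.
  rewrite mulr_ge0 ?exprn_ge0 ?expR_ge0//= expRN ler_pdivrMr ?expR_gt0//.
  (* n^N <= (N + 1)! / n * e^n, from the term of degree N + 1 of the series. *)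
  rewrite mulrAC ler_pdivlMr// -exprSr -ler_pdivrMl ?ltr0n ?fact_gt0// mulrC.
  by apply: le_trans (expR_ge1Dxn N (ler0n _ _)); rewrite lerDr.
- exact: cvg_cst.
- rewrite -[X in _ --> X](mulr0 (N.+1`!%:R)); apply: cvgMr.
  by have := @cvg_harmonic R; rewrite -cvg_shiftS; exact.
Unshelve. all: by end_near. Qed.

Lemma cvg_powRM_expRN {R : realType} (s : R) :
  n.+2%:R `^ s * expR (- n.+2%:R) @[n --> \oo] --> (0 : R).
Proof.
have := @cvg_exprn_expRN R (Num.bound `|s|).
apply: (@squeeze_cvgr _ _ _ _ (fun=> 0)); last exact: cvg_cst.
near=> n.
rewrite mulr_ge0 ?powR_ge0 ?expR_ge0//= ler_wpM2r ?expR_ge0//.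
rewrite -powR_mulrn// ler_powR ?ler1n//.
by rewrite (le_trans (ler_norm _))// ltW// archi_boundP.
Unshelve. all: by end_near. Qed.

(** Integrating by parts over [1/n, n] gives the recurrence up to a boundary
    term that tends to 0; both integrals converge by monotonicity. *)
Lemma egamma_recurrence {R : realType} (s : R) : 0 < s ->
  egamma (s + 1) = (s%:E * egamma s)%E.
Proof.
move=> s0.
pose u n : R := n.+2%:R^-1; pose v n : R := n.+2%:R.
have u0 n : 0 < u n by rewrite invr_gt0.
have uv n : u n < v n.
  by rewrite (@lt_trans _ _ 1) ?invf_lt1 ?ltr1n.
have uv0 n x : x \in `[u n, v n] -> x \in `]0, +oo[.
  by rewrite !in_itv/= andbT => /andP[ux _]; rewrite (lt_le_trans (u0 n)).
have iu : {homo u : m n / (m <= n)%N >-> n <= m}.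
  by move=> m n mn; rewrite lef_pV2 ?posrE// ler_nat.
have iv : {homo v : m n / (m <= n)%N >-> m <= n}.
  by move=> m n mn; rewrite ler_nat.
have cu : u n @[n --> \oo] --> 0.
  by have := @cvg_harmonic R; rewrite -cvg_shiftS; exact.
have UV : \bigcup_n `[u n, v n]%classic = `]0, +oo[%classic.
  apply/seteqP; split => [x [n _ /= /uv0//]|x /=].
  rewrite in_itv/= andbT => x0.
  have : \forall n \near \oo, u n <= x /\ x <= v n.
    near=> n; split; near: n; first exact: (cvgr_le 0 cu).
    exists (Num.bound x) => // n /= xn.
    rewrite (le_trans (ltW (archi_boundP (ltW x0))))// ler_nat.
    by rewrite (leq_trans xn)// leqW.
  by move=> [N _ /(_ N (leqnn _))[]] uN vN; exists N; rewrite //= in_itv/= uN vN.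
have cJ r : (\int[lebesgue_measure]_(x in `[u n, v n])
    (gamma_density r x)%:E)%E @[n --> \oo] --> egamma r.
  apply: ge0_cvg_integral_itvcc => //; first exact: measurable_gamma_density.
  by move=> *; exact: gamma_density_ge0.
pose H (t : R) := - (t `^ s * expR (- t)).
have cHv : H (v n) @[n --> \oo] --> 0.
  by rewrite -[X in _ --> X]oppr0; apply: cvgN; exact: cvg_powRM_expRN.
have cHu : H (u n) @[n --> \oo] --> 0.
  rewrite -[X in _ --> X]oppr0; apply: cvgN.
  apply: (@squeeze_cvgr _ _ _ _ (fun=> 0) (fun n => u n `^ s)).
  - near=> n; rewrite mulr_ge0 ?powR_ge0 ?expR_ge0//= ler_piMr ?powR_ge0//.
    by rewrite expR_le1 oppr_le0 ltW.
  - exact: cvg_cst.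
  - by have /cvg_at_rightP := powR_cvg0 s0; apply; split.
have cH : (H (v n) - H (u n))%:E @[n --> \oo] --> 0%E.
  rewrite -[X in _ --> X%:E](subrr (0 : R)).
  by apply: cvg_EFin; [exact: nearW|exact: cvgB].
have ig r n : lebesgue_measure.-integrable `[u n, v n] (EFin \o gamma_density r).
  apply: continuous_compact_integrable; first exact: segment_compact.
  by apply: continuous_in_subspaceT => x /[!inE]/= /uv0;
    exact: continuous_gamma_density.
have J n : (\int[lebesgue_measure]_(x in `[u n, v n]) (gamma_density (s + 1) x)%:E =
  s%:E * \int[lebesgue_measure]_(x in `[u n, v n]) (gamma_density s x)%:E +
  (H (v n) - H (u n))%:E)%E.
  have -> : ((H (v n) - H (u n))%:E = \int[lebesgue_measure]_(x in `[u n, v n])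
      (gamma_density (s + 1) x - s * gamma_density s x)%:E)%E.
    rewrite EFinB; apply/esym; apply: continuous_FTC2 => //.
    - apply: continuous_in_subspaceT => x /[!inE]/= /uv0 x0.
      apply: continuousB; first exact: continuous_gamma_density.
      by apply: continuousM; [exact: cst_continuous|exact: continuous_gamma_density].
    - have : {within `[u n, v n], continuous H}.
        apply: derivable_within_continuous => x /uv0; rewrite in_itv/= andbT => x0.
        by case: (is_derive_powRM_expRN s _ x0).
      move=> /(continuous_within_itvP _ (uv n))[_ ? ?]; split => // x xuv.
      have /uv0 : x \in `[u n, v n] by exact: subset_itv_oo_cc.
      by rewrite in_itv/= andbT => x0; case: (is_derive_powRM_expRN s _ x0).
    - move=> x xuv; have /uv0 : x \in `[u n, v n] by exact: subset_itv_oo_cc.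
      rewrite in_itv/= andbT => x0; have ? := is_derive_powRM_expRN s _ x0.
      by rewrite derive1E derive_val.
  under [X in (_ + X)%E]eq_integral do rewrite EFinB (EFinM s).
  rewrite integralB//; last 2 first.
  - exact: ig.
  - by apply: integrableZl => //; exact: ig.
  rewrite integralZl//; last exact: ig.
  rewrite [RHS]addeC subeK//.
  rewrite fin_numM//; apply: integrable_fin_num => //; exact: ig.
have cR : (s%:E * \int[lebesgue_measure]_(x in `[u n, v n]) (gamma_density s x)%:E +
  (H (v n) - H (u n))%:E)%E @[n --> \oo] --> (s%:E * egamma s + 0)%E.
  apply: cvgeD => //; first exact: fin_num_adde_defl.
  by apply: cvgeZl.
rewrite adde0 in cR.
apply: (cvg_unique _ (cJ (s + 1))) => //; move: cR; apply: cvg_trans.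
by apply: near_eq_cvg; apply: nearW => n; rewrite -J.
Unshelve. all: by end_near. Qed.

Lemma egamma_ge0 {R : realType} (s : R) : (0 <= egamma s)%E.
Proof. by apply: integral_ge0 => t _; rewrite lee_fin gamma_density_ge0. Qed.

Lemma egamma1 {R : realType} : egamma (1 : R) = 1%E.
Proof.
rewrite -(integral_exponential_pdf (ltr01 : 0 < 1 :> R)) /egamma.
rewrite integral_itv_obnd_cbnd; last first.
  by apply/measurable_EFinP; exact: measurable_gamma_density.
rewrite [LHS]integral_mkcond; apply: eq_integral => t _.
rewrite /exponential_pdf !patchE; case: ifPn => // _.
by rewrite /gamma_density subrr powRr0 mulN1r.
Qed.

Lemma egamma_natS_lty {R : realType} (n : nat) : (egamma (n.+1%:R : R) < +oo)%E.
Proof.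
elim: n => [|n IH]; first by rewrite egamma1 ltry.
by rewrite -natr1 egamma_recurrence ?ltr0n// lte_mul_pinfty ?lee_fin.
Qed.

(** For [1 <= s], [t `^ (s - 1) <= 1 + t ^+ n] as soon as [s - 1 <= n], which
    bounds the integral by the sum of two values at positive integers; for
    small [s] the recurrence reduces to [s + 1]. *)
Lemma egamma_lty {R : realType} (s : R) : 0 < s -> (egamma s < +oo)%E.
Proof.
move=> s0.
have ge1 r : 1 <= r :> R -> (egamma r < +oo)%E.
  move=> r1; pose n := Num.bound r.
  have r0 : 0 <= r by rewrite (le_trans _ r1).
  apply: (@le_lt_trans _ _ (egamma 1 + egamma n.+1%:R)%E); last first.
    by rewrite lte_add_pinfty// ?egamma1 ?ltry ?egamma_natS_lty.
  rewrite /egamma -ge0_integralD//=; last 4 first.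
  - by move=> t _; rewrite lee_fin gamma_density_ge0.
  - by apply/measurable_EFinP; exact: measurable_gamma_density.
  - by move=> t _; rewrite lee_fin gamma_density_ge0.
  - by apply/measurable_EFinP; exact: measurable_gamma_density.
  apply: ge0_le_integral => //=.
  - by move=> t _; rewrite lee_fin gamma_density_ge0.
  - by apply/measurable_EFinP; exact: measurable_gamma_density.
  - by apply: emeasurable_funD; apply/measurable_EFinP; exact: measurable_gamma_density.
  - move=> t; rewrite in_itv/= andbT => t0.
    rewrite -EFinD lee_fin /gamma_density -mulrDl ler_wpM2r ?expR_ge0//.
    rewrite subrr powRr0 -natr1 addrK.
    have [t1|t1] := leP t 1.
      by rewrite (@le_trans _ _ 1) ?lerDl ?powR_ge0//
        -[leRHS](powRr0 t) ger_powR ?t0// subr_ge0.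
    rewrite (@le_trans _ _ (t `^ n%:R)) ?lerDr// ler_powR ?(ltW t1)//.
    by rewrite lerBlDr (le_trans (ltW (archi_boundP r0)))// lerDl.
have : (egamma (s + 1) < +oo)%E by apply: ge1; rewrite lerDr ltW.
rewrite egamma_recurrence//.
have := egamma_ge0 s; case: (egamma s) => [r _ _|_|//]; first by rewrite ltry.
by rewrite gt0_muley// lte_fin.
Qed.

Lemma egamma_gt0 {R : realType} (s : R) : (0 < egamma s)%E.
Proof.
rewrite lt0e egamma_ge0 andbT; apply/eqP => /=.
rewrite /egamma => I0.
have Iabs : (\int[lebesgue_measure]_(t in `]0%R, +oo[)
    `|(gamma_density s t)%:E| = 0)%E.
  by rewrite -[RHS]I0; apply: eq_integral => t _;
    rewrite gee0_abs// lee_fin gamma_density_ge0.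
have [N [mN N0 subN]] : ae_eq (@lebesgue_measure R) `]0%R, +oo[%classic
    (EFin \o gamma_density s) (cst 0%E).
  apply/ae_eq_integral_abs => //.
  by apply/measurable_EFinP; exact: measurable_gamma_density.
have : (lebesgue_measure (`]0%R, +oo[%classic : set R) <= lebesgue_measure N)%E.
  apply: le_measure; rewrite ?inE//.
  apply: subset_trans subN => t /= t0 /(_ t0).
  move=> -[] /eqP; rewrite in_itv/= andbT in t0.
  by rewrite gt_eqF// mulr_gt0 ?powR_gt0 ?expR_gt0.
by rewrite N0 lebesgue_measure_itv/= ltry.
Qed.

Lemma Gamma_gt0 {R : realType} {s : R} : 0 < s -> 0 < Gamma s.
Proof. by move=> s0; rewrite GammaE fine_gt0// egamma_gt0 egamma_lty. Qed.

Lemma GammaD1 {R : realType} (s : R) : 0 < s -> Gamma (s + 1) = s * Gamma s.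
Proof.
move=> s0; rewrite !GammaE egamma_recurrence// fineM//.
by rewrite ge0_fin_numE ?egamma_ge0 ?egamma_lty.
Qed.

(** * Weighted integrals of Lipschitz functions *)

Lemma Rintegral_itv_split {R : realType} (f : R -> R) (p z q : R) :
  lebesgue_measure.-integrable `[p, q] (EFin \o f) -> p <= z <= q ->
  \int[lebesgue_measure]_(t in `[p, q]) f t =
  \int[lebesgue_measure]_(t in `[p, z]) f t +
  \int[lebesgue_measure]_(t in `[z, q]) f t.
Proof.
move=> fi /andP[pz zq]; apply/eqP; rewrite addrC -subr_eq; apply/eqP.
rewrite (@Rintegral_itvB _ f (BLeft p) (BRight q)) ?bnd_simp//.
rewrite Rintegral_itv_obnd_cbnd//; apply: integrableS fi => //.
exact: subset_itvr.
Qed.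

Lemma integrable_kernelM {R : realType} {k h : R -> R} {p q : R} (B : R) :
  lebesgue_measure.-integrable `[p, q] (EFin \o k) ->
  measurable_fun `[p, q] h -> (forall t, t \in `[p, q] -> `|h t| <= B) ->
  lebesgue_measure.-integrable `[p, q] (EFin \o (fun t => k t * h t)).
Proof.
move=> ki mh hB.
rewrite (_ : EFin \o _ = ((EFin \o k) \* (EFin \o h))%E)//.
apply: integrableMl => //; exists B; split; first exact: num_real.
by move=> y By t /= tpq; rewrite (le_trans (hB _ tpq))// ltW.
Qed.

(** Replacing [f t] by [f z] under a nonnegative weight [k] costs at most [M]
    times the distance to [z] integrated against [k]. The Lipschitz condition is used
    only from the fixed point [z], which need not lie in [[p, q]]. *)
Lemma lipschitz_kernel_integral {R : realType} (k f : R -> R) (M p q z : R) :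
  lebesgue_measure.-integrable `[p, q] (EFin \o k) ->
  (forall t, t \in `[p, q] -> 0 <= k t) ->
  measurable_fun `[p, q] f -> 0 <= M ->
  (forall t, t \in `[p, q] -> `|f z - f t| <= M * `|z - t|) ->
  `|\int[lebesgue_measure]_(t in `[p, q]) k t * f z -
    \int[lebesgue_measure]_(t in `[p, q]) (k t * f t)|
  <= M * \int[lebesgue_measure]_(t in `[p, q]) (k t * `|z - t|).
Proof.
move=> ki k0 mf M0 fM.
pose B := `|z| + `|p| + `|q|.
have tB t : t \in `[p, q] -> `|z - t| <= B.
  rewrite in_itv/= => /andP[pt tq]; rewrite /B.
  have := ler_norm z; have := ler_norm (- z); have := ler_norm (- p).
  have := ler_norm q; have := normr_ge0 p; have := normr_ge0 q.
  by rewrite !normrN ler_norml => *; apply/andP; split; lra.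
have mz : measurable_fun `[p, q] (fun t => f z - f t) by exact: measurable_funB.
have mzt : measurable_fun `[p, q] (fun t : R => `|z - t|).
  by apply: measurableT_comp => //; exact: measurable_funB.
have fB t : t \in `[p, q] -> `|f t| <= `|f z| + M * B.
  move=> tpq; rewrite -[f t](subKr (f z)) (le_trans (ler_normB _ _))//.
  by rewrite lerD2l (le_trans (fM _ tpq))// ler_wpM2l// tB.
have i1 := integrable_kernelM _ ki mf fB.
have i2 : lebesgue_measure.-integrable `[p, q] (EFin \o (fun t => k t * (f z - f t))).
  apply: (integrable_kernelM (M * B)) => // t tpq.
  by rewrite (le_trans (fM _ tpq))// ler_wpM2l// tB.
have i3 : lebesgue_measure.-integrable `[p, q] (EFin \o (fun t => k t * `|z - t|)).
  by apply: (integrable_kernelM B) => // t tpq; rewrite normr_id tB.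
have i4 : lebesgue_measure.-integrable `[p, q] (EFin \o (fun t => k t * f z)).
  by apply: (integrable_kernelM `|f z|).
rewrite -RintegralZr// -RintegralB// -RintegralZl//.
under eq_Rintegral do rewrite -mulrBr.
rewrite (le_trans (le_normr_Rintegral _ _))//.
apply: le_Rintegral => //.
- have /integrableP[/measurable_EFinP m2 _] := i2.
  apply: (le_integrable _ _ _ i2) => //=.
    by apply/measurable_EFinP; exact: measurableT_comp.
  by move=> t _; rewrite normr_id.
- by apply: (integrableZl _ M i3).
- move=> t tpq; rewrite normrM ger0_norm ?k0// mulrCA ler_wpM2l ?k0//.
  exact: fM.
Qed.

(** Evaluation of the weighted distance to [z] when [z] lies to the left of the
    interval; the two lemmas that follow treat the other positions. *)
Lemma kernel_dist_le {R : realType} (k : R -> R) (p q z : R) : z <= p ->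
  lebesgue_measure.-integrable `[p, q] (EFin \o k) ->
  lebesgue_measure.-integrable `[p, q] (EFin \o (fun t => k t * t)) ->
  \int[lebesgue_measure]_(t in `[p, q]) (k t * `|z - t|) =
  \int[lebesgue_measure]_(t in `[p, q]) (k t * t) -
  z * \int[lebesgue_measure]_(t in `[p, q]) k t.
Proof.
move=> zp ki kti; rewrite -RintegralZl// -RintegralB//; last first.
  exact: (integrableZl _ z ki).
apply: eq_Rintegral => t; rewrite inE/= in_itv/= => /andP[pt _].
rewrite ler0_norm ?subr_le0 ?(le_trans zp)//; ring.
Qed.

Lemma kernel_dist_ge {R : realType} (k : R -> R) (p q z : R) : q <= z ->
  lebesgue_measure.-integrable `[p, q] (EFin \o k) ->
  lebesgue_measure.-integrable `[p, q] (EFin \o (fun t => k t * t)) ->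
  \int[lebesgue_measure]_(t in `[p, q]) (k t * `|z - t|) =
  z * \int[lebesgue_measure]_(t in `[p, q]) k t -
  \int[lebesgue_measure]_(t in `[p, q]) (k t * t).
Proof.
move=> qz ki kti; rewrite -RintegralZl// -RintegralB//; last first.
  exact: (integrableZl _ z ki).
apply: eq_Rintegral => t; rewrite inE/= in_itv/= => /andP[_ tq].
rewrite ger0_norm ?subr_ge0 ?(le_trans tq)//; ring.
Qed.

Lemma kernel_dist_mid {R : realType} (k : R -> R) (p q z : R) : p <= z <= q ->
  lebesgue_measure.-integrable `[p, q] (EFin \o k) ->
  lebesgue_measure.-integrable `[p, q] (EFin \o (fun t => k t * t)) ->
  \int[lebesgue_measure]_(t in `[p, q]) (k t * `|z - t|) =
  z * \int[lebesgue_measure]_(t in `[p, z]) k t -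
  \int[lebesgue_measure]_(t in `[p, z]) (k t * t) +
  \int[lebesgue_measure]_(t in `[z, q]) (k t * t) -
  z * \int[lebesgue_measure]_(t in `[z, q]) k t.
Proof.
move=> pzq ki kti; have /andP[pz zq] := pzq.
have zB t : t \in `[p, q] -> `| `|z - t| | <= `|q - p|.
  rewrite in_itv/= normr_id => /andP[pt tq].
  rewrite (ger0_norm (_ : 0 <= q - p)) ?subr_ge0 ?(le_trans pz)//.
  by rewrite ler_norml; apply/andP; split; lra.
have mz : measurable_fun `[p, q] (fun t : R => `|z - t|).
  by apply: measurableT_comp => //; exact: measurable_funB.
rewrite (@Rintegral_itv_split _ _ p z q) //; last first.
  exact: (integrable_kernelM _ ki mz zB).
have sl : `[p, z] `<=` `[p, q] by exact: subset_itvl.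
have sr : `[z, q] `<=` `[p, q] by exact: subset_itvr.
rewrite kernel_dist_ge//; try by [apply: integrableS ki|apply: integrableS kti].
rewrite kernel_dist_le//; try by [apply: integrableS ki|apply: integrableS kti].
by rewrite addrA.
Qed.

(** * Logarithmic kernels *)

(** Powers with a positive exponent are continuous on the closed half-line, the
    origin included. *)
Lemma cvg_powR_ge0 {R : realType} {T : Type} (F : set_system T) (g : T -> R)
    (l s : R) : Filter F -> 0 < s -> 0 <= l -> (\forall x \near F, 0 <= g x) ->
  g x @[x --> F] --> l -> g x `^ s @[x --> F] --> l `^ s.
Proof.
move=> FF s0; rewrite le_eqVlt => /predU1P[<- g0 gl|l0 _ gl].
- rewrite powR0 ?gt_eqF//; apply/cvgrPdist_lt => e e0.
  have es0 : 0 < e `^ s^-1 by rewrite powR_gt0.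
  near=> x; have gx : 0 <= g x by near: x.
  rewrite sub0r normrN ger0_norm ?powR_ge0//.
  rewrite -[ltRHS]powRr1 ?(ltW e0)// -(mulVf (lt0r_neq0 s0)) powRrM.
  apply: gt0_ltr_powR => //; rewrite ?nnegrE ?(ltW es0)//.
  rewrite -[ltLHS]ger0_norm// -normrN -[ltLHS]/(`|- g x|) -sub0r.
  by near: x; move/cvgrPdist_lt : gl; exact.
- have cs : {for l, continuous (@powR R ^~ s)}; last exact: cvg_comp gl cs.
  apply/differentiable_continuous/derivable1_diffP.
  by apply: derivable_powR; rewrite in_itv/= l0.
Unshelve. all: by end_near. Qed.

Lemma is_derive_ln_divr {R : realType} (a t : R) : 0 < a -> 0 < t ->
  is_derive t 1 (fun t => ln (t / a)) t^-1.
Proof.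
move=> a0 t0.
have d1 := is_derive1_ln (divr_gt0 t0 a0).
have d2 : is_derive t 1 (fun t : R => t / a) a^-1.
  by apply: is_derive_eq; rewrite /GRing.scale/= mulr1 mulr0 add0r.
have d := @is_derive1_comp _ (@ln R) (fun t => t / a) _ _ _ d1 d2.
apply: (is_derive_eq d).
by rewrite invf_div mulrAC divff ?mul1r// gt_eqF.
Qed.

Lemma is_derive_ln_divl {R : realType} (b t : R) : 0 < b -> 0 < t ->
  is_derive t 1 (fun t => ln (b / t)) (- t^-1).
Proof.
move=> b0 t0.
have d1 := is_derive1_ln (divr_gt0 b0 t0).
have d2 : is_derive t 1 (fun t : R => b / t) (- (b * t ^- 2)).
  have := is_deriveV (f := id) (lt0r_neq0 t0) (is_derive_id t 1).
  move=> d; apply: is_derive_eq; rewrite /GRing.scale/=; ring.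
have d := @is_derive1_comp _ (@ln R) (fun t => b / t) _ _ _ d1 d2.
apply: (is_derive_eq d).
by field; rewrite !gt_eqF.
Qed.

(** The weight of the Hadamard integrals with respect to [dt], for either
    logarithm [g t = ln (t / a)] or [g t = ln (b / t)]. *)
Definition log_kernel {R : realType} (g : R -> R) (s t : R) : R :=
  g t `^ (s - 1) / t.

Lemma log_kernel_ge0 {R : realType} (g : R -> R) (s t : R) : 0 <= t ->
  0 <= log_kernel g s t.
Proof. by move=> t0; rewrite divr_ge0 ?powR_ge0. Qed.

Lemma is_derive_log_kernel {R : realType} {g : R -> R} {e s t : R} :
  0 < t -> 0 < s -> 0 < g t -> is_derive t 1 g (e / t) -> e * e = 1 ->
  is_derive t 1 (fun t => e / s * g t `^ s) (log_kernel g s t).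
Proof.
move=> t0 s0 g0 dg ee.
have dp := @is_derive1_comp _ (@powR R ^~ s) g _ _ _ (is_derive1_powR s g0) dg.
have dq := is_deriveZ (e / s) dp.
apply: (is_derive_eq dq).
rewrite /GRing.scale/= /log_kernel -[RHS]mul1r -ee; field.
by rewrite !gt_eqF.
Qed.

(** What the two logarithms [ln (t / a)] (with [e = 1]) and [ln (b / t)] (with
    [e = -1]) have in common on a subinterval [[p, q]] of [[a, b]]. Positivity
    is required inside the interval only, as each of them vanishes at one
    endpoint of [[a, b]]. *)
Record log_scale {R : realType} (g : R -> R) (e p q : R) : Prop := LogScale {
  log_scale_gt0 : 0 < p;
  log_scale_sqr : e * e = 1;
  log_scale_derive : forall t : R, 0 < t -> is_derive t 1 g (e / t);
  log_scale_cc : forall t, t \in `[p, q] -> 0 <= g t;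
  log_scale_oo : forall t, t \in `]p, q[ -> 0 < g t }.

Arguments log_scale_gt0 {R g e p q}.
Arguments log_scale_sqr {R g e p q}.
Arguments log_scale_derive {R g e p q}.
Arguments log_scale_cc {R g e p q}.
Arguments log_scale_oo {R g e p q}.

Lemma log_scale_sub {R : realType} {g : R -> R} {e p q p' q' : R} :
  log_scale g e p q -> p <= p' -> q' <= q -> log_scale g e p' q'.
Proof.
move=> [p0 ee dg g0 gp] pp' q'q; split => // [|t|t].
- exact: lt_le_trans p0 pp'.
- rewrite in_itv/= => /andP[pt tq]; apply: g0.
  by rewrite in_itv/= (le_trans pp' pt) (le_trans tq q'q).
- rewrite in_itv/= => /andP[pt tq]; apply: gp.
  by rewrite in_itv/= (le_lt_trans pp' pt) (lt_le_trans tq q'q).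
Qed.

Lemma log_scale_left {R : realType} (a q : R) : 0 < a ->
  log_scale (fun t => ln (t / a)) 1 a q.
Proof.
move=> a0; split => // [|t t0|t|t].
- by rewrite mulr1.
- by rewrite div1r; exact: is_derive_ln_divr.
- by rewrite in_itv/= => /andP[at_ _]; rewrite ln_ge0// ler_pdivlMr// mul1r.
- by rewrite in_itv/= => /andP[at_ _]; rewrite ln_gt0// ltr_pdivlMr// mul1r.
Qed.

Lemma log_scale_right {R : realType} (p b : R) : 0 < p -> 0 < b ->
  log_scale (fun t => ln (b / t)) (- 1) p b.
Proof.
move=> p0 b0; split => // [|t t0|t|t].
- by rewrite mulrNN mulr1.
- by rewrite mulNr div1r; exact: is_derive_ln_divl.
- rewrite in_itv/= => /andP[pt tb]; have t0 := lt_le_trans p0 pt.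
  by rewrite ln_ge0// ler_pdivlMr// mul1r.
- rewrite in_itv/= => /andP[pt tb]; have t0 := lt_trans p0 pt.
  by rewrite ln_gt0// ltr_pdivlMr// mul1r.
Qed.

Section log_kernel_integral.
Context {R : realType} {g : R -> R} {e s p q : R}.
Hypotheses (s0 : 0 < s) (gpq : log_scale g e p q).
Let p0 := log_scale_gt0 gpq.
Let ee := log_scale_sqr gpq.
Let dg := log_scale_derive gpq.
Let g0 := log_scale_cc gpq.
Let g_gt0 := log_scale_oo gpq.

Let cg (t : R) : 0 < t -> {for t, continuous g}.
Proof.
by move=> t0; have [dgt _] := dg t t0; exact/differentiable_continuous/derivable1_diffP.
Qed.

Let ct (t : R) : t \in `]p, q[ -> {for t, continuous (log_kernel g s)}.
Proof.
move=> tpq; have t0 : 0 < t by move: tpq; rewrite in_itv/= => /andP[/(lt_trans p0)].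
apply: (@continuousM R R (fun t => g t `^ (s - 1)) (fun t => t^-1)); last first.
  by apply: inv_continuous; rewrite gt_eqF.
have cp : {for g t, continuous (@powR R ^~ (s - 1))}; last first.
  exact: continuous_comp (cg _ t0) cp.
apply/differentiable_continuous/derivable1_diffP.
by apply: derivable_powR; rewrite in_itv/= g_gt0.
Qed.

(** [e / s * g t `^ s] is an antiderivative of the kernel; the integral is
    finite even when the kernel blows up, as [0 < s]. *)
Lemma integral_log_kernel : p <= q ->
  (\int[lebesgue_measure]_(t in `[p, q]) (log_kernel g s t)%:E)%E =
  (e / s * (g q `^ s - g p `^ s))%:E.
Proof.
rewrite le_eqVlt => /predU1P[pq|pq].
  by rewrite -pq set_itv1 integral_set1 subrr mulr0.
have q0 := lt_trans p0 pq.
rewrite (@ge0_continuous_FTC2oo _ _ (fun t => e / s * g t `^ s)) //.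
- by rewrite -EFinB mulrBr.
- move=> t; rewrite in_itv/= => /andP[pt _].
  by rewrite log_kernel_ge0// ltW// (lt_trans p0).
- move=> t tpq; have t0 : 0 < t by move: tpq; rewrite in_itv/= => /andP[/(lt_trans p0)].
  exact: (is_derive_log_kernel t0 s0 (g_gt0 t tpq) (dg t t0) ee).
- apply: cvgMr; apply: cvg_powR_ge0 => //.
  + by apply: g0; rewrite in_itv/= lexx ltW.
  + near=> t; apply/ltW/g_gt0; rewrite in_itv/=; apply/andP; split => //.
  + by apply: cvg_at_right_filter; exact: cg.
- apply: cvgMr; apply: cvg_powR_ge0 => //.
  + by apply: g0; rewrite in_itv/= lexx ltW.
  + near=> t; apply/ltW/g_gt0; rewrite in_itv/=; apply/andP; split => //.
  + by apply: cvg_at_left_filter; exact: cg.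
Unshelve. all: by end_near. Qed.

Lemma integrable_log_kernel : p <= q ->
  lebesgue_measure.-integrable `[p, q] (EFin \o log_kernel g s).
Proof.
move=> pq.
have mk : measurable_fun `]p, q[ (log_kernel g s).
  by apply: open_continuous_measurable_fun => // t; rewrite inE/=; exact: ct.
have {}mk : measurable_fun `[p, q] (log_kernel g s) by exact: measurable_fun_itv_cc mk.
apply/integrableP; split; first exact/measurable_EFinP.
under eq_integral => t.
  rewrite inE/= in_itv/= => /andP[pt _].
  rewrite /= ger0_norm ?log_kernel_ge0 ?(ltW (lt_le_trans p0 pt))//.
  over.
by rewrite integral_log_kernel// ltry.
Qed.

Lemma Rintegral_log_kernel : p <= q ->
  \int[lebesgue_measure]_(t in `[p, q]) log_kernel g s t =
  e / s * (g q `^ s - g p `^ s).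
Proof. by move=> pq; rewrite /Rintegral integral_log_kernel. Qed.

End log_kernel_integral.

(** * Hadamard integrals of Lipschitz functions *)

(** The distance to [z], integrated over [[p, q]] against the kernel. *)
Definition deviation {R : realType} (g : R -> R) (s p q z : R) : R :=
  \int[lebesgue_measure]_(t in `[p, q]) (log_kernel g s t * `|z - t|).

Section deviation.
Context {R : realType} {g : R -> R} {e s p q : R}.
Hypotheses (s0 : 0 < s) (gpq : log_scale g e p q) (pq : p <= q).
Let p0 := log_scale_gt0 gpq.

Let ki := integrable_log_kernel s0 gpq pq.

Let kti : lebesgue_measure.-integrable `[p, q]
  (EFin \o (fun t => log_kernel g s t * t)).
Proof.
apply: (integrable_kernelM q ki) => // t; rewrite in_itv/= => /andP[pt tq].
by rewrite ger0_norm// (le_trans (ltW p0)).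
Qed.

Let Rintegral_log_kernelM p' q' : p <= p' ->
  \int[lebesgue_measure]_(t in `[p', q']) (log_kernel g s t * t) =
  \int[lebesgue_measure]_(t in `[p', q']) (g t `^ (s - 1)).
Proof.
move=> pp'; apply: eq_Rintegral => t; rewrite inE/= in_itv/= => /andP[pt _].
by rewrite /log_kernel mulfVK// gt_eqF// (lt_le_trans p0)// (le_trans pp').
Qed.

Lemma deviation_le z : z <= p -> deviation g s p q z =
  \int[lebesgue_measure]_(t in `[p, q]) (g t `^ (s - 1)) -
  z * (e / s * (g q `^ s - g p `^ s)).
Proof.
move=> zp; rewrite /deviation kernel_dist_le// Rintegral_log_kernelM//.
by rewrite (Rintegral_log_kernel s0 gpq pq).
Qed.

Lemma deviation_ge z : q <= z -> deviation g s p q z =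
  z * (e / s * (g q `^ s - g p `^ s)) -
  \int[lebesgue_measure]_(t in `[p, q]) (g t `^ (s - 1)).
Proof.
move=> zp; rewrite /deviation kernel_dist_ge// Rintegral_log_kernelM//.
by rewrite (Rintegral_log_kernel s0 gpq pq).
Qed.

Lemma deviation_mid z : p <= z <= q -> deviation g s p q z =
  z * (e / s * (g z `^ s - g p `^ s)) -
  \int[lebesgue_measure]_(t in `[p, z]) (g t `^ (s - 1)) +
  \int[lebesgue_measure]_(t in `[z, q]) (g t `^ (s - 1)) -
  z * (e / s * (g q `^ s - g z `^ s)).
Proof.
move=> pzq; have /andP[pz zq] := pzq.
rewrite /deviation kernel_dist_mid// !Rintegral_log_kernelM//.
rewrite (Rintegral_log_kernel s0 (log_scale_sub gpq (lexx p) zq) pz).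
by rewrite (Rintegral_log_kernel s0 (log_scale_sub gpq pz (lexx q)) zq).
Qed.

(** The contribution of one of the two Hadamard integrals to the theorem. *)
Lemma lipschitz_log_kernel (f : R -> R) (M z : R) :
  measurable_fun `[p, q] f -> 0 <= M ->
  (forall t, t \in `[p, q] -> `|f z - f t| <= M * `|z - t|) ->
  `|e / s * (g q `^ s - g p `^ s) * f z -
    \int[lebesgue_measure]_(t in `[p, q]) (g t `^ (s - 1) * f t / t)|
  <= M * deviation g s p q z.
Proof.
move=> mf M0 fM; rewrite -(Rintegral_log_kernel s0 gpq pq).
under [X in _ - X]eq_Rintegral do rewrite mulrAC.
apply: lipschitz_kernel_integral => // t; rewrite in_itv/= => /andP[pt _].
by rewrite log_kernel_ge0// (le_trans (ltW p0)).
Qed.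

End deviation.

Lemma lipschitz_measurable {R : realType} {I : set R} {M : R} {f : R -> R} :
  measurable I -> M.-lipschitz_I f -> measurable_fun I f.
Proof.
move=> mI fM; apply: subspace_continuous_measurable_fun => //.
apply/subspace_continuousP => x Ix; apply/cvgrPdist_le => eps eps0.
have M1 : 0 < `|M| + 1 by rewrite ltr_wpDl.
have d0 : 0 < eps / (`|M| + 1) by rewrite divr_gt0.
near=> t.
have It : I t by near: t; exact: withinT.
have := fM (x, t) (conj Ix It) => /= /le_trans; apply.
have xt : `|x - t| <= eps / (`|M| + 1).
  near: t; apply: cvg_within.
  have : t @[t --> x] --> x by exact: cvg_id.
  by move=> /cvgrPdist_le; exact.
rewrite (@le_trans _ _ ((`|M| + 1) * `|x - t|))//.
  by rewrite ler_wpM2r// (le_trans (ler_norm M))// lerDl.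
by rewrite mulrC -ler_pdivlMr.
Unshelve. all: by end_near. Qed.

Lemma geo_mean_itv {R : realType} {a b lambda : R} : 0 < a -> a < b ->
  0 <= lambda <= 1 -> a <= geo_mean a b lambda <= b.
Proof.
move=> a0 ab /andP[l0 l1]; have b0 := lt_trans a0 ab.
have L0 : 0 <= ln (b / a) by rewrite ln_ge0// ler_pdivlMr// mul1r ltW.
have C0 : 0 < geo_mean a b lambda by rewrite mulr_gt0// powR_gt0.
apply/andP; split.
- have := ln_geo_mean_minus lambda a0 ab.
  rewrite ln_div ?posrE// => /eqP; rewrite subr_eq => /eqP lnC.
  by rewrite -ler_ln ?posrE// lnC lerDr mulr_ge0.
- have := ln_geo_mean_plus lambda a0 ab.
  rewrite ln_div ?posrE// => /eqP; rewrite subr_eq => /eqP lnC.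
  by rewrite -ler_ln ?posrE// lnC lerDr mulr_ge0// subr_ge0.
Qed.

Theorem theorem6 (R : realType) (I : set R) (M : R) (f : R -> R)
    (a b lambda alpha x y : R) :
  is_interval I -> I `<=` `]0, +oo[ ->
  0 <= M -> M.-lipschitz_I f ->
  I a -> I b -> a < b ->
  lambda \in `[0, 1] -> 0 < alpha ->
  x \in `[a, b] -> y \in `[a, b] -> x <= y ->
  `|S_ f x y lambda alpha a b|
    <= alpha * M * C_coeff a b alpha lambda x y / ln (b / a) `^ alpha.
Proof.
move=> iI I0 M0 fM Ia Ib ab.
rewrite !in_itv/= => l01 s0 /andP[ax xb] /andP[ay yb] xy.
have a0 : 0 < a by have := I0 _ Ia; rewrite /= in_itv/= andbT.
have b0 := lt_trans a0 ab.
have /andP[l0 l1] := l01.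
have L0 : 0 < ln (b / a) by rewrite ln_gt0// ltr_pdivlMr// mul1r.
have IT t : a <= t <= b -> I t by exact: iI.
have /andP[aC Cb] := geo_mean_itv a0 ab l01.
have C0 : 0 < geo_mean a b lambda by exact: lt_le_trans aC.
have cE : ln (geo_mean a b lambda / a) `^ alpha =
    lambda `^ alpha * ln (b / a) `^ alpha.
  by rewrite ln_geo_mean_minus// powRM// ltW.
have dE : ln (b / geo_mean a b lambda) `^ alpha =
    (1 - lambda) `^ alpha * ln (b / a) `^ alpha.
  by rewrite ln_geo_mean_plus// powRM// ?subr_ge0 ?(ltW L0).
have E0 c : c != 0 -> ln (c / c) `^ alpha = 0.
  by move=> c0; rewrite divff// ln1 powR0// gt_eqF.
pose dev1 := deviation (fun t => ln (t / a)) alpha a (geo_mean a b lambda) x.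
pose dev2 := deviation (fun t => ln (b / t)) alpha (geo_mean a b lambda) b y.
have mI : measurable I by exact: is_interval_measurable.
have mf p q : a <= p -> q <= b -> measurable_fun `[p, q] f.
  move=> ap qb; apply: (measurable_funS mI); last first.
    exact: lipschitz_measurable mI fM.
  move=> t /=; rewrite in_itv/= => /andP[pt tq].
  by apply: IT; rewrite (le_trans ap pt) (le_trans tq qb).
have fL z t : a <= z <= b -> a <= t <= b -> `|f z - f t| <= M * `|z - t|.
  by move=> /IT Iz /IT It; exact: (fM (z, t) (conj Iz It)).
have gl := log_scale_left a (geo_mean a b lambda) a0.
have gr := log_scale_right (geo_mean a b lambda) b C0 b0.
have mf1 := mf _ _ (lexx a) Cb.
have mf2 := mf _ _ aC (lexx b).
have B1 := lipschitz_log_kernel s0 gl aC f M x mf1 M0.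
have B2 := lipschitz_log_kernel s0 gr Cb f M y mf2 M0.
have xf t : t \in `[a, geo_mean a b lambda] -> `|f x - f t| <= M * `|x - t|.
  rewrite in_itv/= => /andP[at_ tC].
  by apply: fL; rewrite ?ax ?xb// at_ (le_trans tC Cb).
have yf t : t \in `[geo_mean a b lambda, b] -> `|f y - f t| <= M * `|y - t|.
  rewrite in_itv/= => /andP[Ct tb].
  by apply: fL; rewrite ?ay ?yb// tb (le_trans aC Ct).
move: {B1} (B1 xf) {B2} (B2 yf) => B1 B2.
(* The masses of the two kernels are lambda^alpha and (1 - lambda)^alpha times
   ln (b / a)^alpha / alpha: the weights of f x and f y in S_. *)
rewrite !E0 ?gt_eqF// cE dE in B1 B2.
rewrite -/dev1 in B1; rewrite -/dev2 in B2.
(* C_coeff is exactly the total deviation; each case of its definition is one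
   choice of the positions of x and y with respect to the mean C. *)
have devE : dev1 + dev2 = C_coeff a b alpha lambda x y.
  have [Cx|xC] := leP (geo_mean a b lambda) x.
    rewrite C_coeffE1// /dev1 (deviation_ge s0 gl)//.
    rewrite /dev2 (deviation_mid s0 gr) ?(le_trans Cx)//.
    rewrite /C_case1 !E0 ?gt_eqF// cE dE.
    by do 3![move: (Rintegral _ _ _) => ?]; field; rewrite gt_eqF.
  have [Cy|yC] := leP (geo_mean a b lambda) y.
    rewrite C_coeffE2 ?(ltW xC) ?Cy// /dev1 (deviation_mid s0 gl) ?ax ?(ltW xC)//.
    rewrite /dev2 (deviation_mid s0 gr) ?Cy//.
    rewrite /C_case2 !E0 ?gt_eqF// cE dE.
    by do 4![move: (Rintegral _ _ _) => ?]; field; rewrite gt_eqF.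
  rewrite C_coeffE3 ?(ltW yC)// /dev1 (deviation_mid s0 gl) ?ax ?(ltW xC)//.
  rewrite /dev2 (deviation_le s0 gr) ?(ltW yC)//.
  rewrite /C_case3 !E0 ?gt_eqF// cE dE.
  by do 3![move: (Rintegral _ _ _) => ?]; field; rewrite gt_eqF.
rewrite -devE.
have G0 := Gamma_gt0 s0.
have LA0 : 0 < ln (b / a) `^ alpha by rewrite powR_gt0.
rewrite /S_ /hadamard_minus /hadamard_plus GammaD1//.
move: B1 B2.
set I1 := Rintegral _ _ _; set I2 := Rintegral _ _ _ => B1 B2.
set A1 := _ - I1 in B1; set A2 := _ - I2 in B2.
rewrite (_ : _ - _ = alpha / ln (b / a) `^ alpha * (A1 + A2)); last first.
  by rewrite /A1 /A2; field; rewrite !gt_eqF.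
have K0 : 0 <= alpha / ln (b / a) `^ alpha by rewrite divr_ge0// ltW.
rewrite normrM (ger0_norm K0).
rewrite (_ : alpha * M * _ / _ =
   alpha / ln (b / a) `^ alpha * (M * dev1 + M * dev2)); last by ring.
rewrite ler_wpM2l//.
by rewrite (le_trans (ler_normD _ _))// lerD.
Qed.
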